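(* Let $d\ge1$, $\kappa\ge0$. Consider the system on $(\mathbb S^d)^N$ $$\dot x_i=\frac{\kappa}{N}\sum_{j=1}^N\big(x_j-\langle x_i,x_j\rangle x_i\big),\qquad x_i(0)=x_i^0\in\mathbb S^d,\qquad i=1,\dots,N,$$ with $x_i^0\ne x_j^0$ for all $i\neq j$. This system admits no non-constant solution $X=(x_1,\dots,x_N)$ that is (eventually) periodic with positive period, i.e. no non-constant solution for which there exist $T>0$ and $t_0\ge0$ with $X(t+T)=X(t)$ for all $t\ge t_0$.
   Context: $\mathbb S^d$ is the unit sphere in $\mathbb R^{d+1}$ with Euclidean inner product $\langle\cdot,\cdot\rangle$. *)

(* Defs.v *)
From HB Require Import structures.
From mathcomp Require Import all_boot all_order all_algebra.
From mathcomp Require Import all_classical all_reals all_analysis.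

Set Implicit Arguments.
Unset Strict Implicit.
Unset Printing Implicit Defensive.

Import Order.TTheory GRing.Theory Num.Theory.
Import numFieldNormedType.Exports.

Local Open Scope classical_set_scope.
Local Open Scope ring_scope.

(* The norm `|u| of the library on 'rV[R]_n is the sup norm, so the Euclidean
   structure is given explicitly; the two norms induce the same topology, which
   is the one used for derivatives below. *)
Definition inner (R : realType) (n : nat) (u v : 'rV[R]_n) : R :=
  \sum_(k < n) u ord0 k * v ord0 k.

Definition enorm (R : realType) (n : nat) (u : 'rV[R]_n) : R :=
  Num.sqrt (inner u u).

Definition unit_sphere (R : realType) (d : nat) : set 'rV[R]_d.+1 :=
  [set u | enorm u = 1].

Definition velocity (R : realType) (d N : nat) (kappa : R)
    (y : 'I_N -> 'rV[R]_d.+1) (i : 'I_N) : 'rV[R]_d.+1 :=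
  (kappa / N%:R) *: \sum_(j < N) (y j - inner (y i) (y j) *: y i).

(* A solution lives on [0, +oo[: the values of [x i] at negative times are
   unconstrained, and at time 0 the derivative is one-sided. *)
Definition is_solution (R : realType) (d N : nat) (kappa : R)
    (x0 : 'I_N -> 'rV[R]_d.+1) (x : 'I_N -> R -> 'rV[R]_d.+1) : Prop :=
  [/\ forall i, x i 0 = x0 i,
      forall i (t : R), 0 <= t -> unit_sphere (x i t),
      forall i, h^-1 *: (x i h - x i 0) @[h --> 0^'+] -->
                  velocity kappa (fun j => x j 0) i
    & forall i (t : R), 0 < t ->
        is_derive t 1 (x i) (velocity kappa (fun j => x j t) i)].

Definition nonconstant (R : realType) (d N : nat)
    (x : 'I_N -> R -> 'rV[R]_d.+1) : Prop :=
  exists i (s t : R), [/\ 0 <= s, 0 <= t & x i s <> x i t].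

Definition eventually_periodic (R : realType) (d N : nat)
    (x : 'I_N -> R -> 'rV[R]_d.+1) : Prop :=
  exists T t0 : R, [/\ 0 < T, 0 <= t0 &
    forall t, t0 <= t -> forall i, x i (t + T) = x i t].

(* Main.v *)
Require Import Defs.
From mathcomp Require Import all_boot all_order all_algebra.
From mathcomp Require Import all_classical all_reals all_analysis.
From mathcomp Require Import ring lra.

Set Implicit Arguments.
Unset Strict Implicit.
Unset Printing Implicit Defensive.

Import Order.TTheory GRing.Theory Num.Theory.
Import numFieldNormedType.Exports.

Local Open Scope ring_scope.

(** With [S = \sum_j x_j] and [v_i] the velocities, the function
    [kappa / N * |S|^2] has derivative [2 * \sum_i |v_i|^2]. Along a periodic
    regime it takes the same value one period apart, so by Rolle all velocities
    vanish at arbitrarily late times [c]. The field satisfies the one-sided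
    bound [\sum_i <x_i - p_i, v_i> >= - kappa * \sum_i |x_i - p_i|^2] around any
    equilibrium [p], so a solution at an equilibrium at time [c] was there on the
    whole of [[0, c]] (Gronwall backward in time), hence is constant. *)

(** * Euclidean inner product: algebra and product rule *)

Section Inner.
Context (R : realType) (n : nat).
Implicit Types u v w : 'rV[R]_n.

Lemma innerC u v : inner u v = inner v u.
Proof. by apply: eq_bigr => k _; rewrite mulrC. Qed.

Lemma innerBl u v w : inner (u - v) w = inner u w - inner v w.
Proof. by rewrite /inner -sumrB; apply: eq_bigr => k _; rewrite !mxE mulrBl. Qed.

Lemma innerBr u v w : inner w (u - v) = inner w u - inner w v.
Proof. by rewrite !(innerC w) innerBl. Qed.

Lemma innerZl a u v : inner (a *: u) v = a * inner u v.
Proof.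
by rewrite /inner mulr_sumr; apply: eq_bigr => k _; rewrite !mxE mulrA.
Qed.

Lemma innerZr a u v : inner u (a *: v) = a * inner u v.
Proof. by rewrite innerC innerZl innerC. Qed.

Lemma inner0r u : inner u 0 = 0.
Proof. by rewrite /inner big1 // => k _; rewrite mxE mulr0. Qed.

Lemma inner_suml (I : finType) (f : I -> 'rV[R]_n) u :
  inner (\sum_i f i) u = \sum_i inner (f i) u.
Proof.
rewrite /inner exchange_big; apply: eq_bigr => k _ /=.
by rewrite summxE mulr_suml.
Qed.

Lemma inner_sumr (I : finType) (f : I -> 'rV[R]_n) u :
  inner u (\sum_i f i) = \sum_i inner u (f i).
Proof. by rewrite innerC inner_suml; apply: eq_bigr => i _; rewrite innerC. Qed.

Lemma inner_ge0 u : 0 <= inner u u.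
Proof. by apply: sumr_ge0 => k _; rewrite -expr2 sqr_ge0. Qed.

Lemma inner_eq0 u : inner u u = 0 -> u = 0.
Proof.
move=> /psumr_eq0P h; apply/rowP => k; rewrite mxE.
apply/eqP; rewrite -sqrf_eq0 expr2; apply/eqP; apply: h => // j _.
by rewrite -expr2 sqr_ge0.
Qed.

Lemma sum_inner_eq0 (I : finType) (f : I -> 'rV[R]_n) :
  \sum_i inner (f i) (f i) = 0 -> forall i, f i = 0.
Proof.
move=> h i; apply: inner_eq0; move/psumr_eq0P: h; apply => // j _.
exact: inner_ge0.
Qed.

Lemma inner_unit_le1 u v : inner u u = 1 -> inner v v = 1 -> inner u v <= 1.
Proof.
move=> u1 v1; have := inner_ge0 (u - v).
by rewrite innerBl !innerBr u1 v1 (innerC v u); lra.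
Qed.

Lemma is_derive_inner (f g : R -> 'rV[R]_n) (df dg : 'rV[R]_n) (t : R) :
  is_derive t 1 f df -> is_derive t 1 g dg ->
  is_derive t 1 (fun s => inner (f s) (g s)) (inner df (g t) + inner (f t) dg).
Proof.
(* Differentiation of row vectors is entrywise, so the claim reduces to the scalar product rule on
   each summand. *)
have coord (h : R -> 'rV[R]_n) dh k : is_derive t 1 h dh ->
    is_derive t 1 (fun s => h s ord0 k) (dh ord0 k).
  move=> [hd <-]; have /derivable_mxP hd' := hd.
  by apply: DeriveDef; [exact: hd' | rewrite derive_mx // mxE].
move=> fd gd; rewrite /inner -big_split /=.
rewrite (_ : (fun s => _) =
  \sum_(k < n) ((fun s => f s ord0 k) * (fun s => g s ord0 k) : R -> R)).
  apply: is_derive_sum => k.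
  apply: (@is_derive_eq _ _ _ _ _ _ _ _ (is_deriveM (coord _ _ k fd) (coord _ _ k gd))).
  by rewrite /GRing.scale /=; ring.
by apply/funext => s; rewrite fct_sumE.
Qed.

End Inner.

Lemma unit_sphereE (R : realType) (d : nat) (u : 'rV[R]_d.+1) :
  unit_sphere u -> inner u u = 1.
Proof.
rewrite /unit_sphere /enorm /= => h.
by rewrite -[LHS]sqr_sqrtr ?inner_ge0 // h expr1n.
Qed.

(** * The velocity field on unit vectors *)

Section Velocity.
Context (R : realType) (d N : nat) (kappa : R).
Implicit Types y p : 'I_N -> 'rV[R]_d.+1.

(** Mean-field form: the other points act only through their sum, which for unit [y i] is projected
    onto the tangent space at [y i]. *)
Lemma velocityE y i : velocity kappa y i =
  (kappa / N%:R) *: (\sum_j y j - inner (y i) (\sum_j y j) *: y i).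
Proof. by rewrite /velocity sumrB inner_sumr scaler_suml. Qed.

(* [velocity] is tangent, so the [y i]-component of the sum does not contribute *)
Lemma inner_velocity y i : inner (y i) (y i) = 1 ->
  inner (velocity kappa y i) (velocity kappa y i) =
  kappa / N%:R * inner (\sum_j y j) (velocity kappa y i).
Proof.
by move=> y1; rewrite velocityE !(innerZl, innerZr, innerBl, innerBr) y1
  (innerC (y i)); ring.
Qed.

Lemma inner_sum_le y i : (forall j, inner (y j) (y j) = 1) ->
  inner (y i) (\sum_j y j) <= N%:R.
Proof.
move=> y1; rewrite inner_sumr -[in leRHS](card_ord N) -sumr_const.
by apply: ler_sum => j _; exact: inner_unit_le1.
Qed.

(* The cross terms of the Lipschitz estimate add up to the square
   [|\sum_j (y j - p j)|^2 >= 0], and for unit vectors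
   [<y - p, y> = - <y - p, p> = |y - p|^2 / 2]. *)
Lemma velocity_one_sided y p : (1 <= N)%N -> 0 <= kappa ->
  (forall i, inner (y i) (y i) = 1) -> (forall i, inner (p i) (p i) = 1) ->
  (forall i, velocity kappa p i = 0) ->
  - kappa * \sum_i inner (y i - p i) (y i - p i) <=
  \sum_i inner (y i - p i) (velocity kappa y i).
Proof.
move=> N1 k0 y1 p1 p0; set c := kappa / N%:R.
have N0 : (N%:R : R) != 0 by rewrite pnatr_eq0 -lt0n.
have c0 : 0 <= c by rewrite divr_ge0.
have kE : kappa = c * N%:R by rewrite /c divfK.
set E := \sum_j (y j - p j).
apply: (@le_trans _ _ (c * inner E E - c * N%:R *
    \sum_i inner (y i - p i) (y i - p i))).
  by rewrite {1}kE mulNr lerDr mulr_ge0 // inner_ge0.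
rewrite {1}/E inner_suml !mulr_sumr -sumrB; apply: ler_sum => i _.
(* Subtracting the zero velocity at [p] brings out the difference [Y - P], the source of the square
   of [E]. *)
have -> : velocity kappa y i = velocity kappa y i - velocity kappa p i.
  by rewrite p0 subr0.
rewrite !velocityE -/c /E sumrB.
have sy := @inner_sum_le y i y1; have sp := @inner_sum_le p i p1.
move: sy sp; set Y := \sum_j y j; set P := \sum_j p j => sy sp.
have e0 := inner_ge0 (y i - p i).
rewrite -mulrA -mulrBr -scalerBr innerZr ler_wpM2l //.
have ey : inner (y i - p i) (y i) = inner (y i - p i) (y i - p i) / 2.
  by rewrite !(innerBl, innerBr) y1 p1 (innerC (p i) (y i)); field.
have ep : inner (y i - p i) (p i) = - (inner (y i - p i) (y i - p i) / 2).
  by rewrite !(innerBl, innerBr) y1 p1 (innerC (p i) (y i)); field.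
rewrite !(innerBr _ _ (y i - p i)) !innerZr ey ep -!(innerBr _ _ (y i - p i)).
(* The pairing is now [<y i - p i, Y - P>] minus [(<y i, Y> + <p i, P>) * e / 2], and both factors
   of [e] are at most [N]. *)
move: e0 sy sp; set e := inner (y i - p i) _ => e0 sy sp.
have h1 : inner (y i) Y * e <= N%:R * e by rewrite ler_wpM2r.
have h2 : inner (p i) P * e <= N%:R * e by rewrite ler_wpM2r.
rewrite innerBr; lra.
Qed.

End Velocity.

(** * Real calculus: mean value theorem and Gronwall *)

Lemma MVT_closed (R : realType) (f df : R -> R) (a b : R) :
  a <= b -> (forall t, t \in `[a, b] -> is_derive t 1 f (df t)) ->
  exists2 c, c \in `[a, b] & f b - f a = df c * (b - a).
Proof.
move=> ab fd.
have fcont : {within `[a, b], continuous f}%classic.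
  apply: continuous_in_subspaceT => t /set_mem /= tab; have [ft _] := fd t tab.
  by apply: differentiable_continuous; apply/derivable1_diffP.
have fd' t : t \in `]a, b[ -> is_derive t 1 f (df t).
  by move=> /subset_itv_oo_cc /fd.
exact (@MVT_segment R f df a b ab fd' fcont).
Qed.

Lemma is_derive_mull (R : realType) (k : R) (f : R -> R) (df t : R) :
  is_derive t 1 f df -> is_derive t 1 (fun s => k * f s) (k * df).
Proof.
by move=> fd; have : is_derive t 1 (k \*: f) (k *: df) := is_deriveZ k fd.
Qed.

(** The lower bound on [df] makes [f t * expR (C * t)] nondecreasing; it vanishes at [c], so it is
    nonpositive at the earlier time [s]. *)
Lemma gronwall_backward (R : realType) (f df : R -> R) (C s c : R) :
  s <= c -> (forall t, t \in `[s, c] -> is_derive t 1 f (df t)) ->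
  (forall t, t \in `[s, c] -> 0 <= C * f t + df t) ->
  f c = 0 -> f s <= 0.
Proof.
move=> sc fd fge fc0.
pose g t := f t * expR (C * t).
pose dg t := (C * f t + df t) * expR (C * t).
have gd t : t \in `[s, c] -> is_derive t 1 g (dg t).
  move=> tsc; have ft := fd t tsc.
  have et : is_derive t 1 (fun u => expR (C * u)) (expR (C * t) * C).
    apply: (@is_derive1_comp _ expR ( *%R C)).
    by have := is_derive_mull C (is_derive_id t 1); rewrite mulr1.
  apply: (@is_derive_eq _ _ _ _ _ _ _ _ (is_deriveM ft et)).
  by rewrite /dg /GRing.scale /=; ring.
have [t tsc] := @MVT_closed R g dg s c sc gd.
rewrite /g fc0 mul0r sub0r => e.
have : f s * expR (C * s) <= 0.
  by rewrite -oppr_ge0 e !mulr_ge0 ?fge ?expR_ge0 // subr_ge0.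
by rewrite pmulr_lle0 ?expR_gt0.
Qed.

(** * Solutions: equilibria reached and traced back in time *)

Section Solution.
Context (R : realType) (d N : nat) (kappa : R).
Context (x0 : 'I_N -> 'rV[R]_d.+1) (x : 'I_N -> R -> 'rV[R]_d.+1).
Context (solx : is_solution kappa x0 x).

Lemma solution_unit i (t : R) : 0 <= t -> inner (x i t) (x i t) = 1.
Proof. by case: solx => _ h _ _ t0; apply: unit_sphereE; exact: h. Qed.

Lemma is_derive_solution i (t : R) : 0 < t ->
  is_derive t 1 (x i) (velocity kappa (fun j => x j t) i).
Proof. by case: solx => _ _ _; apply. Qed.

(** The one-sided derivative at 0 still forces right continuity: [h] times the difference quotient
    tends to 0, yet for small [h > 0] it equals [x i c - x i 0]. *)
Lemma solution_cst0 i (c : R) : 0 < c ->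
  (forall t : R, 0 < t -> t <= c -> x i t = x i c) -> x i 0 = x i c.
Proof.
move=> c0 xc; have [_ _ /(_ i) xv _] := solx.
have h0 : (h @[h --> (0:R)^'+] --> (0:R))%classic.
  by apply: cvg_at_right_filter; exact: cvg_id.
have lim0 := cvgZ h0 xv; rewrite scale0r in lim0.
have limc : (h *: (h^-1 *: (x i h - x i 0)) @[h --> (0:R)^'+] -->
    x i c - x i 0)%classic.
  apply: cvg_near_cst; near=> h.
  have hgt0 : 0 < h by [].
  rewrite scalerA divff ?gt_eqF // scale1r xc //.
  by near: h; exact: nbhs_right_le.
by rewrite (subr0_eq (cvg_unique (@norm_hausdorff _ _) limc (lim0 _))).
Unshelve. all: by end_near. Qed.

(** Starting at [a > 0] keeps the whole period inside the times where two-sided derivatives are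
    available. *)
Lemma periodic_equilibrium (T a : R) : 0 < T -> 0 < a ->
  (forall i, x i (a + T) = x i a) ->
  exists2 c, a <= c & forall i, velocity kappa (fun j => x j c) i = 0.
Proof.
move=> T0 a0 per.
pose S (t : R) : 'rV[R]_d.+1 := \sum_j x j t.
pose dS (t : R) : 'rV[R]_d.+1 := \sum_j velocity kappa (fun j => x j t) j.
have Sd (t : R) : 0 < t -> is_derive t 1 S (dS t).
  move=> t0; rewrite (_ : S = \sum_j x j).
    by apply: is_derive_sum => j; exact: is_derive_solution.
  by apply/funext => u; rewrite fct_sumE.
pose W (t : R) : R := kappa / N%:R * inner (S t) (S t).
pose dW (t : R) : R := kappa / N%:R * (2 * inner (S t) (dS t)).
have Wd (t : R) : 0 < t -> is_derive t 1 W (dW t).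
  move=> t0.
  apply: is_derive_mull; rewrite mulr2n mulrDl mul1r [X in X + _]innerC.
  exact: is_derive_inner (Sd t t0) (Sd t t0).
have aaT : a < a + T by rewrite ltrDl.
have Wd' (t : R) : t \in `[a, a + T] -> is_derive t 1 W (dW t).
  by rewrite in_itv /= => /andP[at_ _]; apply: Wd; exact: lt_le_trans at_.
have [c caT] := @MVT_closed R W dW a (a + T) (ltW aaT) Wd'.
have -> : W (a + T) = W a.
  by rewrite /W /S; under eq_bigr do rewrite per.
rewrite subrr addrAC subrr add0r => /esym/eqP.
rewrite mulf_eq0 (gt_eqF T0) orbF => /eqP dW0.
move: caT; rewrite in_itv /= => /andP[ac _]; exists c => //.
apply: sum_inner_eq0.
(* By [inner_velocity], each squared speed is [kappa / N] times the pairing of [S c] with that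
   velocity; summing gives half of [dW c]. *)
transitivity (dW c / 2); last by rewrite dW0 mul0r.
have -> : dW c / 2 = kappa / N%:R * inner (S c) (dS c).
  by rewrite /dW mulrCA mulrC mulKf ?pnatr_eq0.
rewrite /dS inner_sumr mulr_sumr; apply: eq_bigr => i _.
by apply: inner_velocity; apply: solution_unit; rewrite (le_trans (ltW a0)).
Qed.

(** Gronwall is applied to the squared distance [f] from the configuration at time [c], the
    equilibrium [p] of [velocity_one_sided]. Time 0, where the derivative is one-sided, is left to
    [solution_cst0]. *)
Lemma equilibrium_backward (c : R) : (1 <= N)%N -> 0 <= kappa -> 0 < c ->
  (forall i, velocity kappa (fun j => x j c) i = 0) ->
  forall i (t : R), 0 < t -> t <= c -> x i t = x i c.
Proof.
move=> N1 k0 c0 vc i t t0 tc.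
pose e j (s : R) : 'rV[R]_d.+1 := x j s - x j c.
pose f (s : R) : R := \sum_j inner (e j s) (e j s).
pose df (s : R) : R := 2 * \sum_j inner (e j s) (velocity kappa (fun l => x l s) j).
have fd (s : R) : 0 < s -> is_derive s 1 f (df s).
  move=> s0; rewrite (_ : f = \sum_j (fun s => inner (e j s) (e j s))).
    rewrite /df mulr_sumr; apply: is_derive_sum => j.
    have ed : is_derive s 1 (e j) (velocity kappa (fun l => x l s) j).
      apply: (@is_derive_eq _ _ _ _ _ _ _ _
        (is_deriveB (is_derive_solution j s0) (is_derive_cst (x j c) s 1))).
      by rewrite subr0.
    apply: (@is_derive_eq _ _ _ _ _ _ _ _ (is_derive_inner ed ed)).
    by rewrite innerC mulr2n mulrDl mul1r.
  by apply/funext => u; rewrite fct_sumE.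
have pos s : s \in `[t, c] -> 0 < s.
  by rewrite in_itv /= => /andP[ts _]; exact: lt_le_trans ts.
have ft0 : f t <= 0.
  (* The rate is [2 * kappa] because differentiating a square doubles the one-sided bound. *)
  apply: (@gronwall_backward _ f df (2 * kappa) t c tc) => [s /pos|s /pos s0|].
  - exact: fd.
  - have := @velocity_one_sided _ _ _ kappa (x^~ s) (x^~ c) N1 k0
      (fun j => solution_unit j (ltW s0)) (fun j => solution_unit j (ltW c0)) vc.
    by rewrite /df /f /e; lra.
  - by rewrite /f big1 // => j _; rewrite /e subrr inner0r.
have /sum_inner_eq0 /(_ i) : f t = 0.
  by apply/eqP; rewrite eq_le ft0 sumr_ge0 // => j _; exact: inner_ge0.
by move/eqP; rewrite subr_eq0 => /eqP.
Qed.

End Solution.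

Theorem corollary4p3 (R : realType) (d N : nat) (kappa : R)
    (x0 : 'I_N -> 'rV[R]_d.+1)
    (hd : (1 <= d)%N) (hN : (1 <= N)%N) (hkappa : 0 <= kappa)
    (hx0 : forall i, unit_sphere (x0 i))
    (hneq : forall i j, i != j -> x0 i <> x0 j) :
  ~ exists x : 'I_N -> R -> 'rV[R]_d.+1,
      [/\ is_solution kappa x0 x, nonconstant x & eventually_periodic x].
Proof.
move=> [x [solx [i [s [t [s0 t0 xst]]]] [T [b [T0 b0 per]]]]].
(* This [a] is positive, lies past the onset [b] of periodicity, and exceeds both [s] and [t], so
   these two times fall in [[0, c]]. *)
pose a := 1 + b + s + t.
have [c ac vc] : exists2 c, a <= c &
    forall j, velocity kappa (fun l => x l c) j = 0.
  by apply: (periodic_equilibrium solx T0) => [|j]; [|apply: per]; rewrite /a; lra.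
have c0 : 0 < c by move: ac; rewrite /a; lra.
have cst r : 0 <= r -> r <= c -> x i r = x i c.
  rewrite le_eqVlt => /predU1P[<- _|].
    by apply: (solution_cst0 solx c0); exact: (equilibrium_backward solx).
  exact: (equilibrium_backward solx).
by apply: xst; rewrite !cst //; move: ac; rewrite /a; lra.
Qed.
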